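(* The product $\sqcup$ on $\mathcal{H}_{\ge1,+}$ has a unique extension to a commutative associative bilinear product on $\mathcal{H}_{\ge0,+}$, still denoted $\sqcup$, such that $[0]\sqcup[\vec s]=[0,\vec s]$ for every basis element $[\vec s]=[s_1,\dots,s_k]$ of $\mathcal{H}_{\ge0,+}$ and such that $I$ is a Rota–Baxter operator of weight $0$ on $(\mathcal{H}_{\ge0,+},\sqcup)$, i.e. $I(a)\sqcup I(b)=I(a\sqcup I(b))+I(I(a)\sqcup b)$ for all $a,b$.
   Context: On words in letters $x_0,x_1$ the shuffle product $\sqcup\!\sqcup$ is defined by $1\sqcup\!\sqcup w=w\sqcup\!\sqcup 1=w$ and $(au)\sqcup\!\sqcup(bv)=a(u\sqcup\!\sqcup bv)+b(au\sqcup\!\sqcup v)$ for letters $a,b$, extended bilinearly. For $n=0,1$ let $\mathcal{H}_{\ge n,+}$ be the $\mathbb{Q}$-vector space with basis the symbols $[s_1,\dots,s_k]$ with $k\ge1$ and all $s_i\in\mathbb{Z}_{\ge n}$; so $\mathcal{H}_{\ge1,+}\subseteq\mathcal{H}_{\ge0,+}$. The product $\sqcup$ on $\mathcal{H}_{\ge1,+}$ is defined by $[\vec s]\sqcup[\vec t]=\eta(\eta^{-1}([\vec s])\sqcup\!\sqcup\eta^{-1}([\vec t]))$, where $\eta$ is the linear bijection from the $\mathbb{Q}$-span of the words $x_0^{s_1-1}x_1\cdots x_0^{s_k-1}x_1$ ($k\ge1,s_i\ge1$) onto $\mathcal{H}_{\ge1,+}$ sending such a word to $[s_1,\dots,s_k]$.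 The linear operator $I$ on $\mathcal{H}_{\ge0,+}$ is $I([s_1,s_2,\dots,s_k])=[s_1+1,s_2,\dots,s_k]$. *)

(* Defs.v *)
From HB Require Import structures.
From mathcomp Require Import all_boot all_order all_algebra.
From mathcomp Require Import sesquilinear.
From mathcomp.multinomials Require Import freeg.

Set Implicit Arguments.
Unset Strict Implicit.
Unset Printing Implicit Defensive.

Import GRing.Theory.
Local Open Scope ring_scope.

Section LinearExtension.

Variables (K : choiceType) (M : lmodType rat) (f : K -> M).

Lemma fglift_linear : linear (fglift f).
Proof.
have addE : {morph fglift f : x y / x + y}.
  have subE : {morph fglift f : x y / x - y} := lift_is_additive f.
  have f0 : fglift f 0 = 0 by rewrite -(subrr 0) subE subrr.
  have fN y : fglift f (- y) = - fglift f y by rewrite -sub0r subE f0 sub0r.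
  by move=> x y; rewrite -{1}(opprK y) subE fN opprK.
have sumE (r : seq K) (c : K -> rat) :
    fglift f (\sum_(x <- r) << c x *g x >>) = \sum_(x <- r) c x *: f x.
  elim: r => [|x r IH]; last by rewrite !big_cons addE liftU IH.
  by rewrite !big_nil -(subrr 0) (lift_is_additive f) subrr.
move=> a p q; rewrite addE; congr (_ + _).
have -> : a *: p = \sum_(x <- dom p) << a * coeff x p *g x >> by [].
have -> : fglift f p = \sum_(x <- dom p) coeff x p *: f x.
  by rewrite -[in LHS](freeg_sumE p) sumE.
by rewrite sumE scaler_sumr; apply: eq_bigr => x _; rewrite scalerA.
Qed.

HB.instance Definition _ :=
  GRing.isLinear.Build rat {freeg K / rat} M _ (fglift f) fglift_linear.

Lemma fgliftU (x : K) : fglift f << x >> = f x.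
Proof. by rewrite liftU scale1r. Qed.

Lemma freegU_scale (c : rat) (x : K) : << c *g x >> = c *: << x >>.
Proof. by apply/eqP/freeg_eqP=> y; rewrite coeffZ !coeffU mul1r. Qed.

Lemma linear_ext (g h : {linear {freeg K / rat} -> M}) :
  (forall x, g << x >> = h << x >>) -> g =1 h.
Proof.
move=> gh p; rewrite -(freeg_sumE p) !linear_sum; apply: eq_bigr => x _.
by rewrite freegU_scale !linearZ /= gh.
Qed.

End LinearExtension.

(* The symbols [s_1, ..., s_k] with k >= 1 and all s_i >= n. *)
Record symb (n : nat) := Symb {
  parts :> seq nat;
  symbP : (parts != [::]) && all (leq n) parts }.

HB.instance Definition _ n := [isSub for @parts n].
HB.instance Definition _ n := [Choice of symb n by <:].

Notation Hge n := {freeg (symb n) / rat}.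

Definition basis (n : nat) (s : symb n) : Hge n := << s >>.

Lemma symb0_subproof (a : nat) (s : seq nat) :
  (a :: s != [::]) && all (leq 0) (a :: s).
Proof. by rewrite /=; apply/allP. Qed.

(* [a, s_1, ..., s_k] *)
Definition symb0 (a : nat) (s : seq nat) : symb 0 :=
  Symb (symb0_subproof a s).

Lemma symb_incl_subproof (s : symb 1) : (parts s != [::]) && all (leq 0) s.
Proof. by case/andP: (symbP s) => -> _; apply/allP. Qed.

Definition symb_incl (s : symb 1) : symb 0 := Symb (symb_incl_subproof s).

Definition incl : Hge 1 -> Hge 0 := fglift (fun s => basis (symb_incl s)).

(* The default 0 of head is never used, as symbols are nonempty. *)
Definition opI : Hge 0 -> Hge 0 :=
  fglift (fun s : symb 0 => basis (symb0 (head 0 s).+1 (behead s))).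

HB.instance Definition _ := GRing.Linear.copy incl (fglift _).
HB.instance Definition _ := GRing.Linear.copy opI (fglift _).

Notation letter := bool (only parsing).
Definition x0 : letter := false.
Definition x1 : letter := true.

Notation word := (seq letter) (only parsing).
Notation QX := {freeg word / rat}.

Definition lmul (a : letter) : QX -> QX :=
  fglift (fun w : word => << a :: w >> : QX).

HB.instance Definition _ a := GRing.Linear.copy (lmul a) (fglift _).

Fixpoint shuffle_word (u : word) : word -> QX :=
  fix shuffle_u (v : word) : QX :=
    match u, v with
    | [::], _ => << v >>
    | _, [::] => << u >>
    | a :: u', b :: v' => lmul a (shuffle_word u' v) + lmul b (shuffle_u v')
    end.

Definition shuffle (p q : QX) : QX :=
  fglift (fun u => fglift (fun v => shuffle_word u v) q) p.

Definition word_of (s : seq nat) : word :=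
  flatten [seq rcons (nseq a.-1 x0) x1 | a <- s].

Definition eta_inv : Hge 1 -> QX :=
  fglift (fun s : symb 1 => << word_of s >> : QX).

(* decode 1 inverts word_of; the counter a is 1 + the number of letters x0 read
   since the last x1. *)
Fixpoint decode (a : nat) (w : word) : seq nat :=
  match w with
  | [::] => [::]
  | b :: w' => if b == x1 then a :: decode 1 w' else decode a.+1 w'
  end.

(* eta is extended by 0 to the words that are not of the form word_of s; this
   extension plays no role, see etaK and eta_inv_shuffle1. *)
Definition eta_word (w : word) : Hge 1 :=
  if insub (decode 1 w) is Some s then
    if word_of (parts s) == w then basis s else 0
  else 0.

Definition eta : QX -> Hge 1 := fglift eta_word.

HB.instance Definition _ := GRing.Linear.copy eta_inv (fglift _).
HB.instance Definition _ := GRing.Linear.copy eta (fglift _).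

Definition shuffle1 (a b : Hge 1) : Hge 1 := eta (shuffle (eta_inv a) (eta_inv b)).

Lemma decode_nseq a m w : decode a (nseq m x0 ++ x1 :: w) = (a + m)%N :: decode 1 w.
Proof. by elim: m a => [|m IH] a /=; rewrite ?addn0 // IH addSnnS. Qed.

Lemma word_ofK (s : seq nat) : all (leq 1) s -> decode 1 (word_of s) = s.
Proof.
elim: s => [|a s IH] //= /andP[a1 s1].
by rewrite /word_of /= cat_rcons decode_nseq (IH s1) add1n prednK.
Qed.

Lemma eta_word_of (s : symb 1) : eta_word (word_of s) = basis s.
Proof.
have /andP[_ s1] := symbP s.
by rewrite /eta_word word_ofK // valK eqxx.
Qed.

Lemma etaK : cancel eta_inv eta.
Proof.
apply: (linear_ext (g := eta \o eta_inv) (h := idfun)) => s /=.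
by rewrite /eta_inv /eta !fgliftU eta_word_of.
Qed.

Definition ends_x1 (w : word) : bool := (w != [::]) && (last x0 w == x1).

Lemma word_of_ends_x1 (s : symb 1) : ends_x1 (word_of s).
Proof.
have /andP[] := symbP s; case/lastP: (parts s) => [|r a] // _ _.
rewrite /ends_x1 /word_of map_rcons flatten_rcons last_cat last_rcons eqxx andbT.
by rewrite -size_eq0 size_cat size_rcons addnS.
Qed.

Lemma ends_x1_decode (a : nat) (w : word) : (0 < a)%N -> ends_x1 w ->
  [/\ decode a w != [::], all (leq 1) (decode a w)
    & word_of (decode a w) = nseq a.-1 x0 ++ w].
Proof.
elim: w a => [//|b w IH] a a0; case: (w =P [::]) => [-> | /eqP wn].
  by case: b => //= _; split; rewrite ?a0 // /word_of /= cats0 cats1.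
rewrite /ends_x1 /= (_ : last b w = last x0 w); last by case: (w) wn.
move=> e; have w1 : ends_x1 w by rewrite /ends_x1 wn.
case: b => /=.
  have [_ p1 p2] := IH 1%N isT w1; split; rewrite ?a0 //.
  by rewrite /word_of /= in p2 *; rewrite p2 cat_rcons.
have [p0 p1 p2] := IH a.+1 isT w1; split=> //; rewrite p2 /=.
case: a a0 {IH p0 p1 p2} => // a _ /=.
by elim: a => //= a ->.
Qed.

Lemma eta_wordK (w : word) : ends_x1 w -> eta_inv (eta_word w) = << w >>.
Proof.
move=> /(ends_x1_decode (isT : 0 < 1)%N) [p0 p1 p2]; rewrite /eta_word.
by rewrite insubT ?p0 // => P /=; rewrite p2 eqxx /eta_inv fgliftU /= p2.
Qed.

Lemma shuffle_word_ends_x1 (u v : word) :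
  (u == [::]) || ends_x1 u -> (v == [::]) || ends_x1 v ->
  (u != [::]) || (v != [::]) ->
  eta_inv (eta (shuffle_word u v)) = shuffle_word u v.
Proof.
pose pr : QX -> QX := fglift (fun w => if ends_x1 w then << w >> else 0).
pose prL : {linear QX -> QX} := GRing.Linear.clone _ _ _ _ pr (fglift _).
have prl a p : prL p = p -> prL (lmul a p) = lmul a p.
  move=> <-; apply: (linear_ext (g := prL \o lmul a \o prL) (h := lmul a \o prL)).
  move=> w /=; rewrite /pr !fgliftU; case: ifP => [/andP[wn e]|]; last by rewrite !linear0.
  rewrite /lmul !fgliftU /ends_x1 /=.
  by rewrite (_ : last a w = last x0 w) ?e //; case: (w) wn.
suff prs : (u == [::]) || ends_x1 u -> (v == [::]) || ends_x1 v ->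
    (u != [::]) || (v != [::]) -> prL (shuffle_word u v) = shuffle_word u v.
  move=> hu hv huv; rewrite -(prs hu hv huv).
  apply: (linear_ext (g := eta_inv \o eta \o prL) (h := prL)) => w /=.
  rewrite /pr !fgliftU; case: ifP => [e|_]; last by rewrite !linear0.
  by rewrite /eta fgliftU eta_wordK.
have prw w : ends_x1 w -> prL << w >> = << w >>.
  by move=> e; rewrite /= /pr fgliftU e.
have tl a w : (a :: w == [::]) || ends_x1 (a :: w) ->
    (w == [::]) || ends_x1 w.
  by case: w => //= b w; rewrite /ends_x1.
elim: u v => [|a u IHu] v.
  by case: v => [|b v] // _ /= hv _; rewrite -[RHS]prw.
elim: v => [|b v IHv] hu hv _.
  by rewrite -[RHS]prw.
have -> : shuffle_word (a :: u) (b :: v) =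
  lmul a (shuffle_word u (b :: v)) + lmul b (shuffle_word (a :: u) v) by [].
rewrite linearD !prl ?IHu ?IHv ?orbT //; [exact: tl hv|exact: tl hu].
Qed.

Lemma eta_inv_shuffle1 (a b : Hge 1) :
  eta_inv (shuffle1 a b) = shuffle (eta_inv a) (eta_inv b).
Proof.
rewrite /shuffle1 /shuffle; set q := eta_inv b; set f := fun u : word => _.
apply: (linear_ext (g := eta_inv \o eta \o fglift f \o eta_inv)
                   (h := fglift f \o eta_inv)) => s.
rewrite /= /eta_inv !fgliftU -/eta_inv /f /q; set sh := shuffle_word _.
apply: (linear_ext (g := eta_inv \o eta \o fglift sh \o eta_inv)
                   (h := fglift sh \o eta_inv)) => t.
rewrite /= /eta_inv !fgliftU -/eta_inv /sh.
have es := word_of_ends_x1 s; have et := word_of_ends_x1 t.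
by apply: shuffle_word_ends_x1; rewrite ?es ?et ?orbT //; case/andP: es => ->.
Qed.

Definition rota_baxter0 (A : zmodType) (mul : A -> A -> A) (P : A -> A) : Prop :=
  forall a b : A, mul (P a) (P b) = P (mul a (P b)) + P (mul (P a) b).

Definition shuffle_extension (mul : Hge 0 -> Hge 0 -> Hge 0) : Prop :=
  [/\ forall a b : Hge 1, mul (incl a) (incl b) = incl (shuffle1 a b),
      commutative mul,
      associative mul,
      forall s : symb 0,
        mul (basis (symb0 0 [::])) (basis s) = basis (symb0 0 s)
    & rota_baxter0 mul opI].

(* Main.v *)
(* Write I for the letter x0 and y for x1. The symbol [s_1, ..., s_k] becomes the
   word I^s_1 y ... I^s_k y; dropping its last letter y identifies the symbols
   with s_i >= 0 with all words in I and y, and [0] with the empty word. The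
   product must then satisfy
     1 * v = y v,  y u * v = y (u * v),  I u * I v = I (u * I v + I u * v),
   which, with commutativity, determines it, whence uniqueness. Conversely this
   recursion defines a product, whose commutativity and associativity follow by
   induction on words. The symbols with s_i >= 1 are the image of the words ending
   in x1 under the substitution x0 -> I, x1 -> I y (the last y being dropped), and
   comparing recursions shows that it carries the shuffle product to *. *)

Require Import Defs.
From HB Require Import structures.
From mathcomp Require Import all_boot all_order all_algebra.
From mathcomp Require Import sesquilinear.
From mathcomp.multinomials Require Import freeg.

Set Implicit Arguments.
Unset Strict Implicit.
Unset Printing Implicit Defensive.

Import GRing.Theory.
Local Open Scope ring_scope.

(** * Induction and bilinear extension on free modules *)

Lemma freeg_lin_ind (K : choiceType) (P : {freeg K / rat} -> Prop) :
  P 0 -> (forall a x p, P p -> P (a *: << x >> + p)) -> forall p, P p.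
Proof.
move=> P0 PS p; rewrite -(freeg_sumE p).
elim: (dom p) => [|x r IH]; first by rewrite big_nil.
by rewrite big_cons freegU_scale; apply: PS.
Qed.

Section BilinearExtension.

Variables (K L : choiceType) (M : lmodType rat) (f : K -> L -> M).

Definition bilift (p : {freeg K / rat}) (q : {freeg L / rat}) : M :=
  fglift (fun u => fglift (f u) q) p.

Lemma bilift_bilinear :
  bilinear_for (GRing.Scale.Law.clone _ _ *:%R _)
    (GRing.Scale.Law.clone _ _ *:%R _) bilift.
Proof.
split=> [q|p] a x y; first by rewrite /bilift linearP.
rewrite /bilift; elim/freeg_lin_ind: p => [|c u p IH].
  by rewrite !linear0 /= scaler0 addr0.
rewrite !linearP /= IH !fgliftU linearP /= !scalerDr !scalerA (mulrC c a).
by rewrite addrACA.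
Qed.

HB.instance Definition _ :=
  bilinear_isBilinear.Build rat {freeg K / rat} {freeg L / rat} M _ _ bilift
    bilift_bilinear.

Lemma biliftU u v : bilift << u >> << v >> = f u v.
Proof. by rewrite /bilift !fgliftU. Qed.

Lemma bilinear_ext (g h : {bilinear {freeg K / rat} -> {freeg L / rat} -> M}) :
  (forall u v, g << u >> << v >> = h << u >> << v >>) -> g =2 h.
Proof.
move=> gh p q; elim/freeg_lin_ind: p => [|a u p IHp]; first by rewrite !linear0l.
rewrite !linearPl IHp; congr (_ *: _ + _).
elim/freeg_lin_ind: q {IHp} => [|b v q IHq]; first by rewrite !linear0r.
by rewrite !linearPr gh IHq.
Qed.

End BilinearExtension.

(** * The product on words in I and y *)

Lemma lmulU a w : lmul a << w >> = << a :: w >> :> QX.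
Proof. exact: fgliftU. Qed.

(** The empty word encodes [[0]], so it is no unit but prepends [x1]. The clauses for a right factor
    that is empty or starts with [x1] mirror those for the left one, as commutativity demands. *)
Fixpoint prod_word (u : seq bool) : seq bool -> QX :=
  fix prod_u (v : seq bool) : QX :=
    match u, v with
    | [::], _ => << x1 :: v >>
    | true :: u', _ => lmul x1 (prod_word u' v)
    | _, [::] => << x1 :: u >>
    | _, true :: v' => lmul x1 (prod_u v')
    | false :: u', false :: v' => lmul x0 (prod_word u' v + prod_u v')
    end.

Lemma prod_word_nil v : prod_word [::] v = << x1 :: v >>.
Proof. by case: v. Qed.

Lemma prod_word_x1 u v : prod_word (x1 :: u) v = lmul x1 (prod_word u v).
Proof. by case: v. Qed.

Lemma prod_word_x0 u v : prod_word (x0 :: u) (x0 :: v) =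
  lmul x0 (prod_word u (x0 :: v) + prod_word (x0 :: u) v).
Proof. by []. Qed.

Lemma prod_wordC u v : prod_word u v = prod_word v u.
Proof.
elim: u v => [|a u IHu].
  by elim=> [|[] v IHv] //; rewrite prod_word_x1 -IHv !prod_word_nil lmulU.
elim=> [|b v IHv].
  by case: a => //; rewrite prod_word_x1 IHu !prod_word_nil lmulU.
case: a b IHv => [] [] IHv; rewrite ?prod_word_x1 ?prod_word_x0 //.
- rewrite IHu prod_word_x1 -IHv prod_word_x1 IHu; congr lmul.
- by rewrite IHu /=; case: (u).
- by rewrite -IHv.
- by rewrite IHu IHv addrC.
Qed.

Definition wprod : QX -> QX -> QX := bilift prod_word.
HB.instance Definition _ := Bilinear.copy wprod (bilift _).

Lemma wprodU u v : wprod << u >> << v >> = prod_word u v.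
Proof. exact: biliftU. Qed.

Lemma wprodC p q : wprod p q = wprod q p.
Proof.
elim/freeg_lin_ind: p => [|a u p IHp]; first by rewrite linear0l linear0r.
rewrite linearPl linearPr /= IHp; congr (_ *: _ + _).
elim/freeg_lin_ind: q {IHp} => [|b v q IHq]; first by rewrite linear0l linear0r.
by rewrite linearPl linearPr /= IHq !wprodU prod_wordC.
Qed.

Lemma wprod_lmul1 p q : wprod (lmul x1 p) q = lmul x1 (wprod p q).
Proof.
elim/freeg_lin_ind: p => [|a u p IHp]; first by rewrite linear0 !linear0l linear0.
rewrite linearP !linearPl /= linearP /= IHp; congr (_ *: _ + _).
elim/freeg_lin_ind: q {IHp} => [|b v q IHq]; first by rewrite !linear0r linear0.
by rewrite !linearPr /= linearP /= IHq lmulU !wprodU prod_word_x1.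
Qed.

Lemma wprod_lmul0 p q : wprod (lmul x0 p) (lmul x0 q) =
  lmul x0 (wprod p (lmul x0 q)) + lmul x0 (wprod (lmul x0 p) q).
Proof.
elim/freeg_lin_ind: p => [|a u p IHp].
  by rewrite linear0 !linear0l linear0 addr0.
rewrite linearP !linearPl /= !linearP /= IHp addrACA -scalerDr; congr (_ *: _ + _).
elim/freeg_lin_ind: q {IHp} => [|b v q IHq].
  by rewrite linear0 !linear0r linear0 addr0.
rewrite linearP !linearPr /= !linearP /= IHq addrACA -scalerDr; congr (_ *: _ + _).
by rewrite !lmulU !wprodU prod_word_x0 linearD.
Qed.

Lemma wprod_lmul1r p q : wprod p (lmul x1 q) = lmul x1 (wprod p q).
Proof. by rewrite wprodC wprod_lmul1 wprodC. Qed.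

Lemma wprod_nill p : wprod << [::] >> p = lmul x1 p.
Proof.
elim/freeg_lin_ind: p => [|a u p IHp]; first by rewrite linear0r linear0.
by rewrite linearPr linearP /= IHp wprodU prod_word_nil lmulU.
Qed.

Lemma wprod_nilr p : wprod p << [::] >> = lmul x1 p.
Proof. by rewrite wprodC wprod_nill. Qed.

(** Two uses of the Rota-Baxter identity expand either bracketing into [lmul x0] of three terms, in
    each of which one factor has lost its leading [x0]; the hypotheses match these terms. *)
Lemma wprod_lmul0A p q r (I := lmul x0) :
  wprod p (wprod (I q) (I r)) = wprod (wprod p (I q)) (I r) ->
  wprod (I p) (wprod q (I r)) = wprod (wprod (I p) q) (I r) ->
  wprod (I p) (wprod (I q) r) = wprod (wprod (I p) (I q)) r ->
  wprod (I p) (wprod (I q) (I r)) = wprod (wprod (I p) (I q)) (I r).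
Proof.
rewrite {}/I => Ap Aq Ar.
transitivity (lmul x0 (wprod p (wprod (lmul x0 q) (lmul x0 r)) +
  wprod (lmul x0 p) (wprod q (lmul x0 r)) +
  wprod (lmul x0 p) (wprod (lmul x0 q) r))).
  rewrite !(wprod_lmul0 q) !linearDr /= !wprod_lmul0 !linearD /=.
  by rewrite -!addrA; congr (_ + _); rewrite addrCA.
rewrite {}Ap {}Aq {}Ar.
rewrite !(wprod_lmul0 p) !linearDl /= !wprod_lmul0 !linearD /=.
by rewrite -!addrA; congr (_ + _); rewrite addrCA.
Qed.

(** An empty factor or a leading [x1] puts an [x1] in front of both sides; what remains is the case
    of three leading [x0]. *)
Lemma wprod_wordA u v w :
  wprod << u >> (wprod << v >> << w >>) = wprod (wprod << u >> << v >>) << w >>.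
Proof.
elim: u v w => [|a u IHu] v w; first by rewrite !wprod_nill wprod_lmul1.
rewrite -lmulU; case: a; first by rewrite !wprod_lmul1 IHu.
elim: v w => [|b v IHv] w.
  by rewrite wprod_nill wprod_nilr wprod_lmul1 wprod_lmul1r.
rewrite -lmulU; case: b; first by rewrite wprod_lmul1r !wprod_lmul1 wprod_lmul1r IHv.
elim: w => [|c w IHw].
  by rewrite !wprod_nilr wprod_lmul1r.
rewrite -lmulU; case: c; first by rewrite !wprod_lmul1r IHw.
apply: wprod_lmul0A; [|rewrite (lmulU _ w); exact: IHv|exact: IHw].
by rewrite !lmulU; apply: IHu.
Qed.

Lemma wprodA : associative wprod.
Proof.
move=> p q r; elim/freeg_lin_ind: p => [|a u p IHp]; first by rewrite !linear0l.
rewrite !linearPl /= IHp; congr (_ *: _ + _).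
elim/freeg_lin_ind: q {IHp} => [|b v q IHq].
  by rewrite linear0l !linear0r linear0l.
rewrite linearPr !linearPl linearPr /= IHq; congr (_ *: _ + _).
elim/freeg_lin_ind: r {IHq} => [|c w r IHr]; first by rewrite !linear0r.
by rewrite !linearPr /= IHr wprod_wordA.
Qed.

(** * Symbols as words *)

Fixpoint enc (s : seq nat) : seq bool :=
  match s with
  | [::] => [::]
  | [:: a] => nseq a x0
  | a :: t => nseq a x0 ++ x1 :: enc t
  end.

Arguments enc s : simpl never.

Fixpoint dec (w : seq bool) : symb 0 :=
  match w with
  | [::] => symb0 0 [::]
  | true :: w' => symb0 0 (dec w')
  | false :: w' => symb0 (head 0 (dec w')).+1 (behead (dec w'))
  end.

Lemma enc0 t : t != [::] -> enc (0%N :: t) = x1 :: enc t.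
Proof. by case: t. Qed.

Lemma encS a t : enc (a.+1 :: t) = x0 :: enc (a :: t).
Proof. by case: t. Qed.

Lemma decK w : enc (dec w) = w.
Proof.
elim: w => // -[] w /=;
  have /andP[] := symbP (dec w); case: (parts _) => // a t _ _ IH.
  by rewrite -[RHS]/(x1 :: w) -IH -enc0.
by rewrite -[RHS]/(x0 :: w) -IH -encS.
Qed.

Lemma encK (s : symb 0) : dec (enc s) = s.
Proof.
apply: val_inj => /=; have /andP[] := symbP s; move: (parts s) => {}s s0 _.
elim: s s0 => // a t IH _; elim: a => [|a IHa]; last by rewrite encS /= IHa.
by case: t IH => // b t IH; rewrite enc0 // [LHS]/= IH.
Qed.

Definition encl : Hge 0 -> QX := fglift (fun s : symb 0 => << enc s >> : QX).
Definition decl : QX -> Hge 0 := fglift (fun w : seq bool => basis (dec w)).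

HB.instance Definition _ := GRing.Linear.copy encl (fglift _).
HB.instance Definition _ := GRing.Linear.copy decl (fglift _).

Lemma enclU (s : symb 0) : encl << s >> = << enc s >>.
Proof. exact: fgliftU. Qed.

Lemma declU w : decl << w >> = << dec w >>.
Proof. exact: fgliftU. Qed.

Lemma declK : cancel decl encl.
Proof.
apply: (linear_ext (g := encl \o decl) (h := idfun)) => w /=.
by rewrite declU enclU decK.
Qed.

Lemma enclK : cancel encl decl.
Proof.
apply: (linear_ext (g := decl \o encl) (h := idfun)) => s /=.
by rewrite enclU declU encK.
Qed.

Lemma decl_lmul0 p : decl (lmul x0 p) = opI (decl p).
Proof.
move: p; apply: (linear_ext (g := decl \o lmul x0) (h := opI \o decl)) => w /=.
by rewrite lmulU !declU /opI fgliftU.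
Qed.

Lemma encl_opI p : encl (opI p) = lmul x0 (encl p).
Proof. by rewrite -{1}(enclK p) -decl_lmul0 declK. Qed.

(** * Comparison with the shuffle product *)

Fixpoint subst_word (w : seq bool) : seq bool :=
  match w with
  | [::] => [::]
  | [:: true] => [:: x0]
  | true :: w' => x0 :: x1 :: subst_word w'
  | false :: w' => x0 :: subst_word w'
  end.

(* The empty word is sent to 0 only for definiteness: with the last x1 dropped it
   has no image. *)
Definition subst : QX -> QX :=
  fglift (fun w : seq bool => if w == [::] then 0 else << subst_word w >>).

HB.instance Definition _ := GRing.Linear.copy subst (fglift _).

Lemma substU a w : subst << a :: w >> = << subst_word (a :: w) >>.
Proof. exact: fgliftU. Qed.

(** The block of an entry a >= 1 goes to I^(a-1) I y = I^a y; the last block loses its y on both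
    sides. *)
Lemma subst_word_of s : s != [::] -> all (leq 1) s ->
  subst_word (word_of s) = enc s.
Proof.
elim: s => // -[|a] s IH _ //= s1.
rewrite /word_of /= -/(word_of s) cat_rcons.
elim: a => [|a IHa]; last by rewrite encS -IHa.
rewrite encS; case: s s1 IH => // b s s1 /(_ isT s1) IH.
(* The first letter of [word_of (b :: s)] is exposed, so that the preceding [x1] is seen not to be
   the last letter and keeps its y. *)
rewrite enc0 // -IH /=; case: (b) s1 => // k _.
rewrite /word_of /=; by case: k.
Qed.

Lemma encl_incl a : encl (incl a) = subst (eta_inv a).
Proof.
move: a; apply: (linear_ext (g := encl \o incl) (h := subst \o eta_inv)) => s /=.
have /andP[s0 s1] := symbP s.
rewrite /incl /eta_inv !fgliftU enclU /= -(subst_word_of s0 s1).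
by have /andP[] := word_of_ends_x1 s; case: (word_of _) => // b w; rewrite substU.
Qed.

(** What follows I in the image of the letter [a]: y for [x1], nothing for [x0]. *)
Definition lmul_if (a : bool) (p : QX) : QX := if a then lmul x1 p else p.

(** The second letter [b] keeps [a] from being the last one, so no y is dropped from the image of
    [a]. *)
Lemma subst_lmul a b p :
  subst (lmul a (lmul b p)) = lmul x0 (lmul_if a (subst (lmul b p))).
Proof.
elim/freeg_lin_ind: p => [|c w p IH]; first by case: a; rewrite /= !linear0.
have -> : subst (lmul a (lmul b (c *: << w >> + p))) =
  c *: subst (lmul a (lmul b << w >>)) + subst (lmul a (lmul b p)).
  by rewrite !linearP.
rewrite IH !lmulU !substU.
by case: a {IH} => /=; rewrite !linearP /= !lmulU substU ?lmulU.
Qed.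

(** The shuffle of two words that are not both empty is a combination of nonempty words, to which
    [subst_lmul] applies. *)
Lemma subst_lmul_shuffle a u v : (u != [::]) || (v != [::]) ->
  subst (lmul a (shuffle_word u v)) =
  lmul x0 (lmul_if a (subst (shuffle_word u v))).
Proof.
case: u v => [|b u] [|c v] //= _; rewrite -?lmulU ?subst_lmul //.
rewrite !linearD /= !subst_lmul.
by case: a; rewrite /= !linearD.
Qed.

(* Of r only the value subst (shuffle_word u v) with q = subst v is of interest; q
   and r are abstract so that the lemma serves both arguments of the shuffle. *)
Lemma subst_head a u q r : ends_x1 (a :: u) ->
  (u = [::] -> r = q) -> (ends_x1 u -> r = wprod (subst << u >>) q) ->
  exists2 m, subst << a :: u >> = lmul x0 m & wprod m q = lmul_if a r.
Proof.
case: u => [|b u] au r0 rS.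
  (* The image of the final [x1] has lost its y; multiplication by the empty word restores it. *)
  case: a au => // _; exists << [::] >>; first by rewrite substU lmulU.
  by rewrite r0 // wprod_nill.
exists (lmul_if a (subst << b :: u >>)); first by rewrite -!lmulU subst_lmul.
by rewrite rS //; case: (a); rewrite //= wprod_lmul1.
Qed.

(** Both images start with [x0], so their product obeys the Rota-Baxter identity, whose two terms
    are the images of the two terms of the shuffle recursion. *)
Lemma subst_shuffle_word u v : ends_x1 u -> ends_x1 v ->
  subst (shuffle_word u v) = wprod (subst << u >>) (subst << v >>).
Proof.
elim: u v => // a u IHu; elim=> // b v IHv au bv.
have [m mE mv] := subst_head au (q := subst << b :: v >>)
  (r := subst (shuffle_word u (b :: v))) (fun u0 => ltac:(by rewrite u0))
  (fun eu => IHu _ eu bv).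
have [n nE un] := subst_head bv (q := subst << a :: u >>)
  (r := subst (shuffle_word (a :: u) v)) (fun v0 => ltac:(by rewrite v0))
  (fun ev => ltac:(by rewrite IHv // wprodC)).
transitivity (subst (lmul a (shuffle_word u (b :: v))) +
    subst (lmul b (shuffle_word (a :: u) v))); first by rewrite -linearD.
rewrite !subst_lmul_shuffle ?orbT // -mv -un {mv un} mE nE.
by rewrite (wprodC n) wprod_lmul0.
Qed.

Lemma encl_shuffle1 a b :
  encl (incl (shuffle1 a b)) = wprod (encl (incl a)) (encl (incl b)).
Proof.
(* [shuffle] unfolds to a [bilift], which makes it bilinear. *)
rewrite !encl_incl eta_inv_shuffle1 -[shuffle]/(bilift shuffle_word).
elim/freeg_lin_ind: a => [|c s a IHa]; first by rewrite !linear0 !linear0l linear0.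
rewrite !linearP /= !linearPl linearP /= IHa; congr (_ *: _ + _).
elim/freeg_lin_ind: b {IHa} => [|d t b IHb].
  by rewrite !linear0 !linear0r linear0.
rewrite !linearP /= !linearPr linearP /= IHb; congr (_ *: _ + _).
rewrite /eta_inv !fgliftU biliftU.
by apply: subst_shuffle_word; apply: word_of_ends_x1.
Qed.

(** * Existence, by transport back to symbols *)

Definition mul0 (a b : Hge 0) : Hge 0 := decl (wprod (encl a) (encl b)).

Lemma mul0_bilinear :
  bilinear_for (GRing.Scale.Law.clone _ _ *:%R _)
    (GRing.Scale.Law.clone _ _ *:%R _) mul0.
Proof.
by split=> [b|b] c x y; rewrite /mul0 linearP /= ?linearPl ?linearPr linearP.
Qed.

HB.instance Definition _ :=
  bilinear_isBilinear.Build rat (Hge 0) (Hge 0) (Hge 0) _ _ mul0 mul0_bilinear.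

Lemma encl_mul0 a b : encl (mul0 a b) = wprod (encl a) (encl b).
Proof. exact: declK. Qed.

Lemma mul0_extension : shuffle_extension mul0.
Proof.
split.
- by move=> a b; rewrite /mul0 -encl_shuffle1 enclK.
- by move=> a b; rewrite /mul0 wprodC.
- by move=> a b c; rewrite /mul0 !declK wprodA.
- move=> s; rewrite /mul0 /basis !enclU wprod_nill lmulU declU /=.
  by rewrite encK.
- move=> a b; apply: (can_inj enclK).
  by rewrite linearD /= !encl_opI !encl_mul0 !encl_opI wprod_lmul0.
Qed.

(** * Uniqueness *)

(** This is the condition on [[0]], which is [dec [::]], extended by linearity. *)
Lemma decl_lmul1 (mul : {bilinear Hge 0 -> Hge 0 -> Hge 0}) p :
  shuffle_extension mul -> decl (lmul x1 p) = mul << dec [::] >> (decl p).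
Proof.
case=> _ _ _ cons0 _.
elim/freeg_lin_ind: p => [|c w p IH]; first by rewrite !linear0.
by rewrite !linearP /= IH lmulU !declU [mul _ << _ >>]cons0.
Qed.

(** Every extension must follow the recursion of [prod_word]: the condition on [[0]] and
    associativity settle a leading [x1], Rota-Baxter settles two leading [x0], and commutativity the
    rest. *)
Lemma decl_prod_word (mul : {bilinear Hge 0 -> Hge 0 -> Hge 0}) u v :
  shuffle_extension mul -> decl (prod_word u v) = mul << dec u >> << dec v >>.
Proof.
move=> ext; have [_ mulC mulA _ rb] := ext.
(* Since y u = 1 * u, associativity gives (y u) * v = 1 * (u * v) = y (u * v). *)
have x1E u' v' : decl (prod_word u' v') = mul << dec u' >> << dec v' >> ->
    decl (prod_word (x1 :: u') v') = mul << dec (x1 :: u') >> << dec v' >>.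
  move=> IH; rewrite prod_word_x1 (decl_lmul1 _ ext) IH mulA -(declU u').
  by rewrite -(decl_lmul1 _ ext) lmulU declU.
have nilE v' : decl (prod_word [::] v') = mul << dec [::] >> << dec v' >>.
  by rewrite prod_word_nil -lmulU (decl_lmul1 _ ext) declU.
elim: u v => [|a u IHu] v; first exact: nilE.
case: a; first exact: x1E.
elim: v => [|b v IHv]; first by rewrite prod_wordC mulC nilE.
case: b; first by rewrite prod_wordC mulC; apply: x1E; rewrite prod_wordC mulC.
rewrite prod_word_x0 decl_lmul0 linearD /= IHu IHv.
by rewrite -!declU -!lmulU !decl_lmul0 rb !linearD.
Qed.

Lemma shuffle_extension_unique (mul : {bilinear Hge 0 -> Hge 0 -> Hge 0}) :
  shuffle_extension mul -> mul =2 mul0.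
Proof.
move=> ext; apply: bilinear_ext => s t.
by rewrite /= /mul0 !enclU wprodU (decl_prod_word _ _ ext) !encK.
Qed.

Theorem theorem3p2 :
  exists mul : {bilinear Hge 0 -> Hge 0 -> Hge 0},
    shuffle_extension mul /\
    forall mul' : {bilinear Hge 0 -> Hge 0 -> Hge 0},
      shuffle_extension mul' -> mul' =2 mul.
Proof.
exists mul0; split; first exact: mul0_extension.
by move=> mul' /shuffle_extension_unique.
Qed.
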